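(* Let $G$ be a finite group acting on a connected space $X$ with $S=\operatorname{Sing}_G(X)=\bigcup_{g\neq e}X^g$ finite, let $T\subseteq X$ be a finite $G$-invariant subset, and let $\mathcal{D}^T_n(G,S)$ be the subposet of $\mathcal{D}_n(G,T\cup S)$ consisting of the pairs $(\tilde\beta,z)$ with $|z^{-1}(o)|\neq1$ whenever $o\in\mathcal{O}(S)\setminus\mathcal{O}(T)$. For each orbit $o\in\mathcal{O}(T\cup S)$ fix $s_o\in o$ with stabilizer $G_o$. Then for every $(\tilde\beta,z)\in\mathcal{D}^T_n(G,S)$, $$\mathcal{D}^T_n(G,S)_{\leq(\tilde\beta,z)}\cong\prod_{B\in\beta}\Pi_B\times\prod_{o\in\mathcal{O}(T)}\mathcal{D}_{z^{-1}(o)}(G_o)\times\prod_{o\in\mathcal{O}(S)\setminus\mathcal{O}(T)}\mathcal{D}'_{z^{-1}(o)}(G_o).$$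
   Context: ''Space'' means a CW complex or algebraic variety over an algebraically closed field; $\mathcal{O}(T),\mathcal{O}(S)$ are the sets of $G$-orbits in $T$, $S$. For a finite group $H$, a finite $H$-set $U$ and finite set $\tau$: a projectivized $H$-coloring of a finite set $B$ is an equivalence class of $b:B\to H$ with $b\sim bh$; a partial $H$-partition $\tilde\beta$ of $\tau$ is a partition $\beta$ of a subset of $\tau$ into nonempty blocks each with a projectivized $H$-coloring, zero block $Z=\tau\setminus\bigcup B$; $\mathcal{D}_\tau(H,U)$ is the set of pairs $(\tilde\beta,z)$, $z:Z\to U$, ordered by the order generated by (merge) $(\tilde\beta\cup\{\tilde A,\tilde B\},z)\prec(\tilde\beta\cup\{\tilde C\},z)$ with $C=A\cup B$, $c=a\cup bh$ for some $h\in H$, and (color) $(\tilde\beta\cup\{\tilde B\},z)\prec(\tilde\beta,z')$ with $z'|_Z=z$, $z'|_B=f\circ b$ for an $H$-equivariant $f:H\to U$; $\mathcal{D}_n=\mathcal{D}_{[n]}$. The Dowling lattice is $\mathcal{D}_\tau(H)=\mathcal{D}_\tau(H,\{\mathrm{pt}\})$, and $\mathcal{D}'_\tau(H)$ is its subposet of elements whose zero block is not a singleton. $\Pi_B$ is the lattice of set partitions of $B$. $P_{\leq x}$ denotes the lower set of $x$. *)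

(* Defs.v *)
From HB Require Import structures.
From Stdlib Require Export Relation_Operators.
From mathcomp Require Export all_boot all_order all_algebra all_fingroup.
From mathcomp Require Export all_classical all_reals all_analysis.

Set Implicit Arguments.
Unset Strict Implicit.
Unset Printing Implicit Defensive.

Import Order.TTheory.
Local Open Scope classical_set_scope.

(* poset_prod requires its factors to share a display. *)
Fact poset_display : Order.disp_t. Proof. exact: Order.Disp tt tt. Qed.

Section Subposet.
Context {d : Order.disp_t} {P : porderType d}.

Record subposet (p : pred P) : Type := Subposet {
  subposet_val :> P;
  _ : p subposet_val
}.

Variable p : pred P.
HB.instance Definition _ := [isSub for @subposet_val p].
HB.instance Definition _ := [Choice of subposet p by <:].
HB.instance Definition _ := [SubChoice_isSubPOrder of subposet p by <: with d].

End Subposet.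

Definition lower_set d (P : porderType d) (x : P) : porderType d :=
  subposet (fun y : P => (y <= x)%O).

Section DependentProduct.
Context {d : Order.disp_t} {J : Type}.

Definition poset_prod (P : J -> porderType d) : Type := forall j, P j.

Variable P : J -> porderType d.
HB.instance Definition _ := gen_eqMixin (poset_prod P).
HB.instance Definition _ := gen_choiceMixin (poset_prod P).

Definition prod_le (x y : poset_prod P) : bool :=
  `[< forall j, (x j <= y j)%O >].

Fact prod_le_refl : reflexive prod_le.
Proof. by move=> x; apply/asboolP => j. Qed.

Fact prod_le_anti : antisymmetric prod_le.
Proof.
move=> x y /andP[/asboolP xy /asboolP yx].
by apply: functional_extensionality_dep => j; apply: le_anti; rewrite xy yx.
Qed.

Fact prod_le_trans : transitive prod_le.
Proof.
move=> y x z /asboolP xy /asboolP yz; apply/asboolP => j.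
exact: le_trans (xy j) (yz j).
Qed.

HB.instance Definition _ := Order.Le_isPOrder.Build d (poset_prod P)
  prod_le_refl prod_le_anti prod_le_trans.

End DependentProduct.

Definition poset_iso d1 d2 (P : porderType d1) (Q : porderType d2) : Prop :=
  exists2 f : P -> Q, bijective f & {mono f : x y / (x <= y)%O}.

Section SetPartition.
Context {I : finType}.

Record set_partition (B : {set I}) : Type := SetPartition {
  sp_blocks :> {set {set I}};
  _ : finset.partition sp_blocks B
}.

Variable B : {set I}.
HB.instance Definition _ := [isSub for @sp_blocks B].
HB.instance Definition _ := [Choice of set_partition B by <:].

Definition finer (p q : set_partition B) : bool :=
  [forall A in sp_blocks p, [exists C in sp_blocks q, A \subset C]].

Lemma finerP (p q : set_partition B) :
  reflect (forall A, A \in sp_blocks p ->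
             exists2 C, C \in sp_blocks q & A \subset C) (finer p q).
Proof. exact: (iffP 'forall_in_exists_inP). Qed.

Fact finer_refl : reflexive finer.
Proof. by move=> p; apply/finerP => A pA; exists A. Qed.

Fact finer_trans : transitive finer.
Proof.
move=> q p r /finerP pq /finerP qr; apply/finerP => A /pq[C /qr[E rE CE] AC].
by exists E; rewrite ?(fintype.subset_trans AC CE).
Qed.

Fact finer_sub (p q : set_partition B) :
  finer p q -> finer q p -> sp_blocks p \subset sp_blocks q.
Proof.
move=> /finerP pq /finerP qp; apply/fintype.subsetP => A pA.
have [C qC AC] := pq A pA; have [E pE CE] := qp C qC.
have AE := fintype.subset_trans AC CE.
have /and3P[_ triv p0] := valP p.
have [x xA] : exists x, x \in A.
  by apply/finset.set0Pn; apply: contraNneq p0 => <-.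
have AeqE : A = E.
  by rewrite -(def_pblock triv pA xA) (def_pblock triv pE (fintype.subsetP AE x xA)).
suff -> : A = C by [].
by apply/eqP; rewrite finset.eqEsubset AC AeqE CE.
Qed.

Fact finer_anti : antisymmetric finer.
Proof.
move=> p q /andP[pq qp]; apply/val_inj/eqP => /=.
by rewrite finset.eqEsubset !finer_sub.
Qed.

HB.instance Definition _ := Order.Le_isPOrder.Build poset_display
  (set_partition B) finer_refl finer_anti finer_trans.

End SetPartition.

(* Left actions: the equivalence b ~ bh of colorings uses right
   multiplication, and f : H -> U is equivariant for left multiplication,
   whereas the actions of mathcomp's action.v are right actions. *)
Record laction (G : finGroupType) (X : Type) : Type := LAction {
  lact :> G -> X -> X;
  lact1 : forall x, lact 1%g x = x;
  lactM : forall g h x, lact (g * h)%g x = lact g (lact h x)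
}.

Definition trivial_action (G : finGroupType) (X : Type) : laction G X :=
  @LAction G X (fun _ x => x) (fun _ => erefl) (fun _ _ _ => erefl).

Section Action.
Context {G : finGroupType} {X : choiceType}.
Variable a : laction G X.

Definition invariant_set (A : set X) : Prop :=
  forall g x, A x -> A (a g x).

Definition stabilizer (x : X) : {set G} := [set g | a g x == x]%SET.

Fact stabilizer_group_set (x : X) : group_set (stabilizer x).
Proof.
apply/group_setP; split=> [|g h]; rewrite !inE ?lact1 //.
by move=> /eqP gx /eqP hx; rewrite lactM hx gx.
Qed.

Canonical stabilizer_group (x : X) : {group G} :=
  Group (stabilizer_group_set x).

Definition orbit_of (x : X) : set X := range (fun g => a g x).

Definition orbits (A : set X) : set (set X) := orbit_of @` A.

Definition Sing : set X :=
  \bigcup_(g in [set g : G | g != 1%g]) [set x | a g x = x].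

Lemma Sing_invariant : invariant_set Sing.
Proof.
move=> g x [h /= h1 hx]; exists (h ^ g^-1)%g => /=.
  by rewrite -(conj1g g^-1) (inj_eq (conjg_inj _)).
by rewrite conjgE invgK -!lactM !mulgA mulgKV lactM hx.
Qed.

Lemma invariant_setU (A B : set X) :
  invariant_set A -> invariant_set B -> invariant_set (A `|` B).
Proof. by move=> hA hB g x [/hA|/hB]; [left|right]. Qed.

Section Restriction.
Variables (A : set X) (hA : invariant_set A).

Definition restr_lact (g : G) (u : set_type A) : set_type A :=
  exist _ (a g (val u)) (mem_set (hA g (set_mem (valP u)))).

Fact restr_lact1 u : restr_lact 1%g u = u.
Proof. by apply: val_inj; rewrite /= lact1. Qed.

Fact restr_lactM g h u :
  restr_lact (g * h)%g u = restr_lact g (restr_lact h u).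
Proof. by apply: val_inj; rewrite /= lactM. Qed.

Definition restr_action : laction G (set_type A) :=
  LAction restr_lact1 restr_lactM.

End Restriction.

End Action.

(* A coloring of B \subset I is a function I -> option H which is Some exactly
   on B, so that colorings of all subsets of I live in one finite type. *)
Section Coloring.
Context {I : finType} {H : finGroupType}.

Definition coloring : Type := {ffun I -> option H}.
HB.instance Definition _ := Finite.on coloring.

Definition csupp (b : coloring) : {set I} := [set i | b i]%SET.

Definition cmulr (b : coloring) (h : H) : coloring :=
  [ffun i => omap (fun x => x * h)%g (b i)].

Definition cunion (b c : coloring) : coloring :=
  [ffun i => if b i is Some x then Some x else c i].

Definition projectivized (b : coloring) : {set coloring} :=
  [set cmulr b h | h : H]%SET.

(* The members of a projectivized coloring all have the same support. *)
Definition block (C : {set coloring}) : {set I} :=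
  (\bigcup_(b in C) csupp b)%SET.

Definition blocks (bt : {set {set coloring}}) : {set {set I}} :=
  (block @: bt)%SET.

Definition partial_partition (tau : {set I}) (bt : {set {set coloring}}) :
    Prop :=
  [/\ forall C, C \in bt -> exists b, C = projectivized b,
      {in bt &, injective block},
      finset.partition (blocks bt) (finset.cover (blocks bt)) &
      finset.cover (blocks bt) \subset tau].

End Coloring.
Arguments coloring : clear implicits.

Section Dowling.
Context {I : finType} (tau : {set I}) {H : finGroupType} {U : choiceType}.

Definition dowling_data : Type :=
  {set {set coloring I H}} * {ffun I -> option U}.
HB.instance Definition _ := Choice.on dowling_data.

Definition zero_block (bt : {set {set coloring I H}}) : {set I} :=
  (tau :\: finset.cover (blocks bt))%SET.

(* The map z : Z -> U is encoded as a function I -> option U which is Some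
   exactly on Z. *)
Definition dowling_element (x : dowling_data) : Prop :=
  partial_partition tau x.1 /\ [set i | x.2 i]%SET = zero_block x.1.

Record dowling (a : laction H U) : Type := Dowling {
  dowling_val : dowling_data;
  _ : `[< dowling_element dowling_val >]
}.

Variable a : laction H U.
HB.instance Definition _ := [isSub for @dowling_val a].
HB.instance Definition _ := [Choice of dowling a by <:].

Definition dpart (x : dowling a) : {set {set coloring I H}} :=
  (dowling_val x).1.

Definition dzero (x : dowling a) : {ffun I -> option U} :=
  (dowling_val x).2.

Definition dowling_merge (x y : dowling a) : Prop :=
  exists A B b c h,
    [/\ A \in dpart x, B \in dpart x, A != B, b \in A & c \in B] /\
    dpart y = (projectivized (cunion b (cmulr c h)) |: (dpart x :\ A :\ B))%SET
    /\ dzero y = dzero x.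

Definition equivariant (f : H -> U) : Prop :=
  forall g h, f (g * h)%g = a g (f h).

Definition dowling_color (x y : dowling a) : Prop :=
  exists B b f,
    [/\ B \in dpart x, b \in B & equivariant f] /\
    dpart y = (dpart x :\ B)%SET /\
    dzero y = [ffun i => if b i is Some h then Some (f h) else dzero x i].

Definition dowling_step (x y : dowling a) : Prop :=
  dowling_merge x y \/ dowling_color x y.

Definition dowling_le (x y : dowling a) : bool :=
  `[< clos_refl_trans (dowling a) dowling_step x y >].

Lemma dowling_step_card x y :
  dowling_step x y -> (#|dpart y| < #|dpart x|)%N.
Proof.
case=> [[A [B [b [c [h [[xA xB neqAB _ _] [-> _]]]]]]]|].
  have xAB : B \in (dpart x :\ A)%SET by rewrite !inE eq_sym neqAB.
  rewrite (cardsD1 A (dpart x)) xA (cardsD1 B (dpart x :\ A)%SET) xAB.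
  by rewrite add1n ltnS cardsU1 leq_add2r leq_b1.
by case=> B [b [f [[xB _ _] [-> _]]]]; rewrite (cardsD1 B (dpart x)) xB.
Qed.

Lemma dowling_le_card x y :
  clos_refl_trans (dowling a) dowling_step x y ->
  x = y \/ (#|dpart y| < #|dpart x|)%N.
Proof.
elim=> [u v /dowling_step_card|u|u v w _ [->|uv] _ [<-|vw]];
  try by [left | right].
by right; apply: ltn_trans uv.
Qed.

Fact dowling_le_refl : reflexive dowling_le.
Proof. by move=> x; apply/asboolP/rt_refl. Qed.

Fact dowling_le_anti : antisymmetric dowling_le.
Proof.
move=> x y /andP[/asboolP/dowling_le_card[//|xy] /asboolP/dowling_le_card[//|]].
by move=> /(ltn_trans xy); rewrite ltnn.
Qed.

Fact dowling_le_trans : transitive dowling_le.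
Proof.
move=> y x z /asboolP xy /asboolP yz; apply/asboolP; exact: rt_trans xy yz.
Qed.

HB.instance Definition _ := Order.Le_isPOrder.Build poset_display
  (dowling a) dowling_le_refl dowling_le_anti dowling_le_trans.

End Dowling.

Section DowlingLattice.
Context {I : finType} (tau : {set I}) (H : finGroupType).

Definition dowling_lattice : porderType poset_display :=
  dowling tau (trivial_action H unit).

Definition zero_not_singleton (x : dowling tau (trivial_action H unit)) :
    bool :=
  #|zero_block tau (dpart x)| != 1%N.

Definition dowling_lattice' : porderType poset_display :=
  subposet zero_not_singleton.

End DowlingLattice.

Definition zero_fiber (I : finType) (X : choiceType) (A : set X)
    (z : {ffun I -> option (set_type A)}) (o : set X) : {set I} :=
  [set i | if z i is Some u then val u \in o else false]%SET.

Section DowlingT.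
Context (n : nat) {G : finGroupType} {X : choiceType} {a : laction G X}.
Context {T S : set X} (hT : invariant_set a T) (hS : invariant_set a S).

Definition dowlingTS : porderType poset_display :=
  dowling [set: 'I_n]%SET (restr_action (invariant_setU hT hS)).

Definition dowlingT_condition (x : dowlingTS) : bool :=
  `[< forall o, (orbits a S `\` orbits a T) o ->
        #|zero_fiber (dzero x) o| != 1%N >].

Definition dowlingT : porderType poset_display :=
  subposet dowlingT_condition.

End DowlingT.

(* Main.v *)
(* A projectivized coloring is determined by its gains b(i) b(j)^-1, so an
   element (beta, z) is determined by z and the ternary relation expressing that i
   and j lie in one block and have gain h.  In these terms (beta, z) <= (beta', z')
   iff z' extends z and every gain of beta is either a gain of beta' or satisfies
   z'(i) = h z'(j) on the zero block of beta'.  Below a fixed (beta, z) the gains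
   thus split into independent pieces: inside a block B they are forced by beta, so
   only a partition of B remains, and on z^-1(o), writing z(i) = g_i s_o, they have
   the form g_i k g_j^-1 with k in G_o. *)
Require Import Defs.

Set Implicit Arguments.
Unset Strict Implicit.
Unset Printing Implicit Defensive.
Local Open Scope classical_set_scope.

(** * Projectivized colorings and their gains *)

(** The generated order hides the intermediate elements of a chain; the gain criterion removes them.
    Its hard direction is a descent on the number of blocks: if [dle x y] and [x] differs from [y],
    some merge or color step out of [x] still stays below [y]. The components of the product live in
    types that depend on the orbit, through both the index set and the group. Hence no explicit map
    is written: a relation [Phi] between the lower set and the product is shown to be total on both
    sides and to preserve and reflect the order. Its totality on the product side amounts to gluing
    prescribed pieces into one gain relation, which works because the blocks of [x] and the orbit
    fibers are pairwise disjoint. The singleton condition transfers because the zero block of the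
    component at [o] is exactly the set of points that the smaller element itself sends into [o]. *)

Section Gain.
Context {I : finType} {H : finGroupType}.
Implicit Types (b c : coloring I H) (bt : {set {set coloring I H}}).
Local Open Scope group_scope.

Lemma cmulr1 b : cmulr b 1 = b.
Proof. by apply/ffunP => i; rewrite ffunE; case: (b i) => //= h; rewrite mulg1. Qed.

Lemma cmulrM b h k : cmulr (cmulr b h) k = cmulr b (h * k).
Proof. by apply/ffunP => i; rewrite !ffunE; case: (b i) => //= l; rewrite mulgA. Qed.

Lemma mem_projectivized b : b \in projectivized b.
Proof. by apply/imsetP; exists 1 => //; rewrite cmulr1. Qed.

Lemma projectivizedP b c :
  reflect (exists h, c = cmulr b h) (c \in projectivized b).
Proof. by apply: (iffP imsetP) => [[h _ ->]|[h ->]]; exists h. Qed.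

Lemma projectivized_cmulr b h : projectivized (cmulr b h) = projectivized b.
Proof.
apply/setP => c; apply/projectivizedP/projectivizedP => [[k ->]|[k ->]].
  by exists (h * k); rewrite cmulrM.
by exists (h^-1 * k); rewrite cmulrM mulKVg.
Qed.

Lemma projectivized_eq b c : c \in projectivized b -> projectivized c = projectivized b.
Proof. by case/projectivizedP => h ->; exact: projectivized_cmulr. Qed.

Lemma eq_projectivized b c :
  projectivized b = projectivized c -> exists h, b = cmulr c h.
Proof. by move=> bc; apply/projectivizedP; rewrite -bc mem_projectivized. Qed.

Lemma block_projectivized b : block (projectivized b) = csupp b.
Proof.
apply/setP => i; apply/finset.bigcupP/idP => [[c /projectivizedP[h ->]]|].
  by rewrite !inE ffunE; case: (b i).
by exists b => //; exact: mem_projectivized.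
Qed.

Lemma cmulr_Some b h i k : b i = Some k -> cmulr b h i = Some (k * h).
Proof. by rewrite ffunE => ->. Qed.

(** Everything is phrased through representatives. That overlapping supports force equal classes
    yields both the disjointness of the blocks and, since supports are nonempty, the injectivity of
    [block]. *)
Lemma partial_partition_intro (tau : {set I}) bt :
  (forall C, C \in bt -> exists b, C = projectivized b) ->
  (forall b, projectivized b \in bt -> exists i, b i) ->
  (forall b c i, projectivized b \in bt -> projectivized c \in bt ->
     b i -> c i -> projectivized b = projectivized c) ->
  (forall b i, projectivized b \in bt -> b i -> i \in tau) ->
  partial_partition tau bt.
Proof.
move=> proj ne disj sub; split=> //.
- move=> C D bC bD; have [b eC] := proj C bC; have [c eD] := proj D bD.
  move: bC bD; rewrite {}eC {}eD !block_projectivized => bC bD bc.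
  have [i bi] := ne b bC; apply: (disj b c i bC bD bi).
  by move/setP: bc => /(_ i); rewrite !inE bi.
- apply/and3P; split=> //.
  + apply/finset.trivIsetP => _ _ /imsetP[C bC ->] /imsetP[D bD ->].
    have [b eC] := proj C bC; have [c eD] := proj D bD.
    move: bC bD; rewrite {}eC {}eD => bC bD neq.
    rewrite -finset.setI_eq0; apply: contra_neqT neq => /finset.set0Pn[i].
    rewrite !block_projectivized !inE => /andP[bi ci].
    by rewrite -!block_projectivized (disj b c i).
  + apply/imsetP => -[C bC e]; have [b eC] := proj C bC.
    move: bC e; rewrite {}eC block_projectivized => bC e.
    have [i bi] := ne b bC.
    by move/setP: e => /(_ i); rewrite !inE bi.
- apply/fintype.subsetP => i /finset.bigcupP[_ /imsetP[C bC ->]].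
  have [b eC] := proj C bC; move: bC; rewrite eC block_projectivized inE.
  exact: sub.
Qed.

Lemma mem_cover_blocks bt i :
  (forall C, C \in bt -> exists b, C = projectivized b) ->
  reflect (exists2 b, projectivized b \in bt & b i)
    (i \in finset.cover (blocks bt)).
Proof.
move=> proj; apply: (iffP finset.bigcupP) => [[_ /imsetP[C bC ->]]|[b bb bi]].
  have [b eC] := proj C bC; move: bC.
  by rewrite eC block_projectivized inE; exists b.
by exists (csupp b); rewrite ?inE // -block_projectivized; apply: imset_f.
Qed.

Section PartialPartition.
Variables (tau : {set I}) (bt : {set {set coloring I H}}).
Hypothesis bt_pp : partial_partition tau bt.

Lemma pp_proj C : C \in bt -> exists b, C = projectivized b.
Proof. by case: bt_pp => proj _ _ _ /proj. Qed.

Lemma pp_nonempty b : projectivized b \in bt -> exists i, b i.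
Proof.
case: bt_pp => _ _ /and3P[_ _ ne] _ bb.
have : csupp b != finset.set0.
  by apply: contraNneq ne => <-; rewrite -block_projectivized imset_f.
by case/finset.set0Pn => i; rewrite inE; exists i.
Qed.

Lemma pp_disjoint b c i : projectivized b \in bt -> projectivized c \in bt ->
  b i -> c i -> projectivized b = projectivized c.
Proof.
case: bt_pp => _ inj /and3P[_ triv _] _ bb bc bi ci; apply: inj => //.
have bB : block (projectivized b) \in blocks bt by apply: imset_f.
have bC : block (projectivized c) \in blocks bt by apply: imset_f.
rewrite -(def_pblock triv bB (x := i)) ?block_projectivized ?inE //.
by rewrite -(block_projectivized c) (def_pblock triv bC) // block_projectivized inE.
Qed.

Lemma pp_sub b i : projectivized b \in bt -> b i -> i \in tau.
Proof.
case: bt_pp => proj _ _ /fintype.subsetP sub bb bi; apply: sub.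
by apply/mem_cover_blocks => //; exists b.
Qed.

End PartialPartition.

(** The relation also records the support: [i] is colored exactly when [gain bt i i 1] holds. *)
Definition gain bt (i j : I) (h : H) : Prop :=
  exists b v, [/\ projectivized b \in bt, b j = Some v & b i = Some (h * v)].

(** A partial equivalence relation with labels in [H] that multiply under composition. Forbidding
    nontrivial labels on loops makes the label of a pair unique ([gain_inj]). *)
Record is_gain (R : I -> I -> H -> Prop) : Prop := IsGain {
  gain_sym : forall i j h, R i j h -> R j i h^-1;
  gain_trans : forall i j k h l, R i j h -> R j k l -> R i k (h * l);
  gain_id : forall i h, R i i h -> h = 1
}.

(** * From gain relations back to partial partitions *)

Section IsGain.
Variable R : I -> I -> H -> Prop.
Hypothesis gR : is_gain R.

Lemma gain_refl i j h : R i j h -> R i i 1.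
Proof. by move=> r; rewrite -(mulgV h); apply: gain_trans r (gain_sym gR r). Qed.

Lemma gain_refr i j h : R i j h -> R j j 1.
Proof. by move/(gain_sym gR)/gain_refl. Qed.

Lemma gain_inj i j h k : R i j h -> R i j k -> h = k.
Proof.
move=> rh rk; have := gain_id gR (gain_trans gR rh (gain_sym gR rk)).
by move/(canRL (mulgKV _)); rewrite mul1g.
Qed.

(** The coloring of the class of [j] normalized to be 1 at [j]; [pick] has at most one candidate by
    [gain_inj]. *)
Definition gain_row (j : I) : coloring I H :=
  [ffun i => [pick h | `[< R i j h >]]].

Lemma gain_rowP i j h : gain_row j i = Some h <-> R i j h.
Proof.
rewrite ffunE; case: pickP => [k /asboolP rk|none]; split.
- by case=> <-.
- by move/(gain_inj rk) => ->.
- by [].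
- by move=> r; have /asboolP := none h.
Qed.

Definition gain_blocks : {set {set coloring I H}} :=
  [set projectivized (gain_row j) | j in [set j | `[< R j j 1 >]]]%SET.

Lemma gain_blocksP b : projectivized b \in gain_blocks ->
  exists j h, R j j 1 /\ b = cmulr (gain_row j) h.
Proof.
case/imsetP => j; rewrite inE => /asboolP rj /eq_projectivized[h bE].
by exists j, h.
Qed.

Lemma mem_gain_blocks j : R j j 1 -> projectivized (gain_row j) \in gain_blocks.
Proof. by move=> r; apply: imset_f; rewrite inE; apply/asboolP. Qed.

Lemma gain_row_cmulr j h i k :
  cmulr (gain_row j) h i = Some k <-> R i j (k * h^-1).
Proof.
rewrite -gain_rowP ffunE; case: (gain_row j i) => //= l; split=> -[].
  by move=> <-; rewrite mulgK.
by move=> ->; rewrite mulgKV.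
Qed.

Lemma gain_gain_blocks i j h : gain gain_blocks i j h <-> R i j h.
Proof.
split=> [[b [v [/gain_blocksP[k [l [_ ->]]]]]]|r].
  move=> /gain_row_cmulr rj /gain_row_cmulr ri.
  have := gain_trans gR ri (gain_sym gR rj).
  by rewrite invMg invgK !mulgA mulgKV mulgK.
have rj := gain_refr r.
exists (gain_row j), 1; rewrite mem_gain_blocks //; split=> //.
  exact/gain_rowP.
by rewrite mulg1; exact/gain_rowP.
Qed.

Lemma gain_blocks_pp (tau : {set I}) :
  (forall i, R i i 1 -> i \in tau) -> partial_partition tau gain_blocks.
Proof.
move=> sub; apply: partial_partition_intro.
- by move=> C /imsetP[j _ ->]; exists (gain_row j).
- move=> b /gain_blocksP[j [h [rj ->]]]; exists j.
  by rewrite (_ : cmulr _ _ _ = Some h) // gain_row_cmulr mulgV.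
- move=> b c i /gain_blocksP[j [h [rj ->]]] /gain_blocksP[k [l [rk ->]]].
  case ej: (cmulr (gain_row j) h i) => [u|//] _.
  case ek: (cmulr (gain_row k) l i) => [v|//] _.
  move/gain_row_cmulr: ej => ej; move/gain_row_cmulr: ek => ek.
  (* The gain [m] between the two base points satisfies [R k j m], so the row at [j] is the row at
     [k] times [m] on the right: changing the base point does not change the projectivized class. *)
  have jk := gain_trans gR (gain_sym gR ek) ej.
  have kj := gain_sym gR jk.
  rewrite !projectivized_cmulr; set m := _ * _ in jk kj.
  rewrite -(projectivized_cmulr (gain_row k) m); congr projectivized.
  apply/ffunP => t.
  case e: (gain_row j t) => [w|].
    apply/esym/gain_row_cmulr; move/gain_rowP: e => e.
    exact: gain_trans e kj.
  case e': (cmulr _ _ _) => [w|//]; move/gain_row_cmulr: e' => e'.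
  have /gain_rowP := gain_trans gR e' jk.
  by rewrite e.
- move=> b i /gain_blocksP[j [h [_ ->]]].
  case e: (cmulr _ _ _) => [w|//] _; move/gain_row_cmulr: e => e.
  exact: sub (gain_refl e).
Qed.

End IsGain.

Section GainPartialPartition.
Variables (tau : {set I}) (bt : {set {set coloring I H}}).
Hypothesis bt_pp : partial_partition tau bt.

Lemma gain_color b i j h v : projectivized b \in bt -> b j = Some v ->
  gain bt i j h -> b i = Some (h * v).
Proof.
move=> bb bj [c [w [cb cj ci]]].
have /eq_projectivized[k bE] : projectivized b = projectivized c.
  by apply: (pp_disjoint bt_pp (i := j)); rewrite ?bj ?cj.
by move: bj; rewrite bE (cmulr_Some k cj) (cmulr_Some k ci) => -[<-]; rewrite mulgA.
Qed.

Lemma color_gain b i j u v : projectivized b \in bt ->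
  b i = Some u -> b j = Some v -> gain bt i j (u * v^-1).
Proof. by move=> bb bi bj; exists b, v; rewrite mulgKV. Qed.

Lemma gain_is_gain : is_gain (gain bt).
Proof.
split=> [i j h [b [v [bb bj bi]]]|i j k h l r [b [v [bb bk bj]]]|i h [b [v [_ -> [vE]]]]].
- by exists b, (h * v); rewrite mulKg.
- by exists b, v; rewrite (gain_color bb bj r) mulgA.
- by apply: (mulIg v); rewrite -vE mul1g.
Qed.

Lemma gain1P i : gain bt i i 1 <-> exists2 b, projectivized b \in bt & b i.
Proof.
split=> [[b [v [bb bi _]]]|[b bb]]; first by exists b; rewrite ?bi.
by case bi: (b i) => [v|//] _; exists b, v; rewrite mul1g.
Qed.

Lemma gain1_cover i : gain bt i i 1 <-> i \in finset.cover (blocks bt).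
Proof.
have P := mem_cover_blocks i (pp_proj bt_pp).
by rewrite gain1P; split=> /P.
Qed.

Lemma gain1_sub i : gain bt i i 1 -> i \in tau.
Proof. by case/gain1P => b; exact: pp_sub. Qed.

End GainPartialPartition.

(** A coloring is recovered from its gains and one value. At a point [j] colored by [b], some [c] of
    [bt'] is colored too; right multiplication by [w^-1 * v] makes it agree with [b] at [j], and
    equal gains propagate the agreement to all points. *)
Lemma gain_subset tau tau' bt bt' :
  partial_partition tau bt -> partial_partition tau' bt' ->
  (forall i j h, gain bt i j h <-> gain bt' i j h) -> bt \subset bt'.
Proof.
move=> pp pp' E; apply/fintype.subsetP => C bC.
have [b eC] := pp_proj pp bC; move: bC; rewrite {}eC => bb.
have [j] := pp_nonempty pp bb; case bj: (b j) => [v|//] _.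
have /E[c [w [cb cj _]]] : gain bt j j 1 by apply/gain1P; exists b; rewrite ?bj.
suff -> : b = cmulr c (w^-1 * v) by rewrite projectivized_cmulr.
have cb' : projectivized (cmulr c (w^-1 * v)) \in bt'.
  by rewrite projectivized_cmulr.
have cj' : cmulr c (w^-1 * v) j = Some v by rewrite (cmulr_Some _ cj) mulKVg.
apply/ffunP => i; case bi: (b i) => [u|].
  have /E/(gain_color pp' cb' cj') := color_gain bb bi bj.
  by rewrite mulgKV.
case ci: (cmulr _ _ i) => [u|//].
have /E/(gain_color pp bb bj) := color_gain cb' ci cj'.
by rewrite bi.
Qed.

End Gain.

(** * The order of a Dowling poset in terms of gains *)

Section DowlingGain.
Context {I : finType} {tau : {set I}} {H : finGroupType} {U : choiceType}.
Variable a : laction H U.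
Implicit Types (x y w : dowling tau a) (b c : coloring I H).
Local Open Scope group_scope.

Definition dgain x : I -> I -> H -> Prop := gain (dpart x).

Lemma dpart_pp x : partial_partition tau (dpart x).
Proof. by case: x => d dE; have /asboolP[] := dE. Qed.

Lemma dgain_is_gain x : is_gain (dgain x).
Proof. exact: gain_is_gain (dpart_pp x). Qed.

Lemma dgain1_sub x i : dgain x i i 1 -> i \in tau.
Proof. exact: gain1_sub (dpart_pp x) _. Qed.

Lemma mem_zero_block x i :
  i \in zero_block tau (dpart x) <-> i \in tau /\ ~ dgain x i i 1.
Proof.
rewrite inE /dgain (gain1_cover (dpart_pp x)); split.
  by move=> /andP[/negP].
by case=> -> /negP ->.
Qed.

Lemma dzeroP x i : dzero x i <-> i \in tau /\ ~ dgain x i i 1.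
Proof.
rewrite -mem_zero_block; case: x => d dE; have /asboolP[_ /setP/(_ i)] := dE.
by rewrite inE => ->.
Qed.

Lemma dzero_dgain x i j h u : dzero x i = Some u -> dgain x i j h -> False.
Proof.
move=> zi /(gain_refl (dgain_is_gain x)) ri.
by have /dzeroP[] : dzero x i by rewrite zi.
Qed.

Lemma dowling_eq x y : (forall i j h, dgain x i j h <-> dgain y i j h) ->
  dzero x = dzero y -> x = y.
Proof.
move=> E z; apply: val_inj; case: x y E z => [[p z] px] [[q z'] qx] /= E zz'.
rewrite [z]zz'; congr pair; set x := Dowling a px in E; set y := Dowling a qx in E.
apply/eqP; rewrite finset.eqEsubset (gain_subset (dpart_pp x) (dpart_pp y) E).
by apply: (gain_subset (dpart_pp y) (dpart_pp x)) => i j h; symmetry; exact: E.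
Qed.

Lemma dowling_intro (bt : {set {set coloring I H}}) (z : {ffun I -> option U}) :
  partial_partition tau bt ->
  (forall i, z i <-> i \in tau /\ ~ gain bt i i 1) ->
  exists x, dpart x = bt /\ dzero x = z.
Proof.
move=> pp zE; suff el : `[< dowling_element tau (bt, z) >] by exists (Dowling a el).
apply/asboolP; split=> //; apply/setP => i; rewrite !inE.
apply/idP/andP; rewrite zE (gain1_cover pp); last by case=> /negP.
by case=> -> /negP.
Qed.

Lemma dowling_of_gain (R : I -> I -> H -> Prop) (z : {ffun I -> option U}) :
  is_gain R -> (forall i, R i i 1 -> i \in tau) ->
  (forall i, z i <-> i \in tau /\ ~ R i i 1) ->
  exists x, (forall i j h, dgain x i j h <-> R i j h) /\ dzero x = z.
Proof.
move=> gR sub zE.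
have [|x [px zx]] := @dowling_intro (gain_blocks R) z (gain_blocks_pp gR sub).
  by move=> i; rewrite gain_gain_blocks.
by exists x; split=> // i j h; rewrite /dgain px gain_gain_blocks.
Qed.

Lemma dgain_blocks x i j :
  (exists h, dgain x i j h) <->
  exists2 B, B \in blocks (dpart x) & i \in B /\ j \in B.
Proof.
split=> [[h [b [v [xb bj bi]]]]|[_ /imsetP[C xC ->]]].
  exists (block (projectivized b)); first exact: imset_f.
  by rewrite block_projectivized !inE bi bj.
have [b eC] := pp_proj (dpart_pp x) xC; move: xC.
rewrite {}eC block_projectivized !inE => xb.
case bi: (b i) => [u|] [//]; case bj: (b j) => [v|//] _ _.
by exists (u * v^-1); exact: color_gain xb bi bj.
Qed.

Lemma dblocks_eq x B C i : B \in blocks (dpart x) -> C \in blocks (dpart x) ->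
  i \in B -> i \in C -> B = C.
Proof.
have [_ _ /and3P[_ triv _] _] := dpart_pp x => xB xC iB iC.
by rewrite -(def_pblock triv xB iB) (def_pblock triv xC iC).
Qed.

(* The relations between colors that can occur below x: on the zero block any
   two points of the same orbit may be colored compatibly with z. *)
Definition dgainz x (i j : I) (h : H) : Prop :=
  dgain x i j h \/
  exists u v, [/\ dzero x i = Some u, dzero x j = Some v & u = a h v].

Lemma dgainz_sym x i j h : dgainz x i j h -> dgainz x j i h^-1.
Proof.
case=> [r|[u [v [zi zj uE]]]]; first by left; apply: gain_sym (dgain_is_gain x) _ _ _ r.
by right; exists v, u; split=> //; rewrite uE -lactM mulVg lact1.
Qed.

Lemma dgainz_trans x i j k h l : dgainz x i j h -> dgainz x j k l -> dgainz x i k (h * l).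
Proof.
case=> [r|[u [v [zi zj uE]]]]; case=> [r'|[v' [w [zj' zk vE]]]].
- by left; apply: gain_trans (dgain_is_gain x) _ _ _ _ _ r r'.
- by have := dzero_dgain zj' (gain_sym (dgain_is_gain x) r).
- by have := dzero_dgain zj r'.
- right; exists u, w; split=> //; move: zj'; rewrite zj => -[vv].
  by rewrite uE vv vE lactM.
Qed.

Definition dle x y : Prop :=
  (forall i j h, dgain x i j h -> dgainz y i j h) /\
  (forall i u, dzero x i = Some u -> dzero y i = Some u).

Lemma dle_refl x : dle x x.
Proof. by split=> // i j h; left. Qed.

Lemma dle_trans y x w : dle x y -> dle y w -> dle x w.
Proof.
move=> [xy zxy] [yw zyw]; split=> [i j h /xy[/yw//|[u [v [zi zj uE]]]]|i u /zxy/zyw//].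
by right; exists u, v; rewrite (zyw _ _ zi) (zyw _ _ zj).
Qed.

(** Going up can only uncolor points: a point in the zero block of [x] keeps its value in [y], so it
    is not colored there. *)
Lemma dle_dom x y i : dle x y -> dgain y i i 1 -> dgain x i i 1.
Proof.
move=> [_ zxy] r; apply: contrapT => n.
have : dzero x i by apply/dzeroP; split=> //; exact: dgain1_sub r.
case z: (dzero x i) => [u|//] _; exact: dzero_dgain (zxy _ _ z) r.
Qed.

Lemma dle_merge x y : dowling_merge x y -> dle x y.
Proof.
case=> A [B [b [c [h [[xA xB neq bA cB] [py zy]]]]]]; split; last by rewrite zy.
move=> i j k [d [v [xd dj di]]]; left; rewrite /dgain py.
have eA : A = projectivized b.
  have [b' eA] := pp_proj (dpart_pp x) xA; move: bA; rewrite eA.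
  by move/projectivized_eq ->.
have eB : B = projectivized c.
  have [c' eB] := pp_proj (dpart_pp x) xB; move: cB; rewrite eB.
  by move/projectivized_eq ->.
subst A B; set D := cunion _ _.
have bD t u : b t = Some u -> D t = Some u by rewrite ffunE => ->.
(* [cunion] prefers [b], but distinct classes have disjoint supports, so [D] restricts to [b] and to
   [c] times [h]. *)
have cD t u : c t = Some u -> D t = Some (u * h).
  move=> ct; rewrite !ffunE ct; case bt: (b t) => [w|//].
  by case/eqP: neq; apply: (pp_disjoint (dpart_pp x) (i := t)); rewrite ?bt ?ct.
(* Up to right multiplication, which preserves gains, [d] is [b], or [c], or a coloring of an
   untouched class. *)
have [/eq_projectivized[m dE]|dA] := eqVneq (projectivized d) (projectivized b).
  move: dj di; rewrite dE !ffunE.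
  case bj: (b j) => [p|//] [pv]; case bi: (b i) => [q|//] [qv].
  exists D, p; rewrite finset.setU11 (bD _ _ bj) (bD _ _ bi); split=> //.
  by congr Some; apply: (mulIg m); rewrite qv -mulgA pv.
have [/eq_projectivized[m dE]|dB] := eqVneq (projectivized d) (projectivized c).
  move: dj di; rewrite dE !ffunE.
  case cj: (c j) => [p|//] [pv]; case ci: (c i) => [q|//] [qv].
  exists D, (p * h); rewrite finset.setU11 (cD _ _ cj) (cD _ _ ci); split=> //.
  by congr Some; rewrite mulgA; congr (_ * h); apply: (mulIg m); rewrite qv -mulgA pv.
by exists d, v; split=> //; rewrite !inE dA dB xd orbT.
Qed.

Lemma dle_color x y : dowling_color x y -> dle x y.
Proof.
case=> B [b [f [[xB bB fE] [py zy]]]].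
have eB : B = projectivized b.
  have [b' eB] := pp_proj (dpart_pp x) xB; move: bB; rewrite eB.
  by move/projectivized_eq ->.
subst B; split=> [i j k [d [v [xd dj di]]]|i u zi]; last first.
  rewrite zy ffunE; case bi: (b i) => [w|//].
  have [] : False; apply: (dzero_dgain zi (j := i) (h := 1)).
  by apply/gain1P; exists b; rewrite ?bi.
have [/eq_projectivized[m dE]|dB] := eqVneq (projectivized d) (projectivized b).
  move: dj di; rewrite dE !ffunE.
  case bj: (b j) => [p|//] [pv]; case bi: (b i) => [q|//] [qv].
  (* Equivariance turns a gain [k] of the removed class into the relation that [k] moves the new
     value at [j] to the new value at [i]. *)
  right; exists (f q), (f p); rewrite zy !ffunE bi bj; split=> //.
  by rewrite -fE; congr f; apply: (mulIg m); rewrite qv -mulgA pv.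
by left; exists d, v; split=> //; rewrite py !inE dB.
Qed.

Lemma dowling_le_dle x y : (x <= y)%O -> dle x y.
Proof.
move=> /asboolP; elim=> [u v [/dle_merge//|/dle_color//]|u|u v w _ uv _ vw].
  exact: dle_refl.
exact: dle_trans uv vw.
Qed.

(** One point of a class of [x] in the zero block of [y] drags the whole class there: no gain of [x]
    at that point can be a gain of [y], so each is realized by the zero map of [y]. Coloring the
    class accordingly stays below [y]. *)
Lemma dle_color_step x y i :
  dle x y -> dgain x i i 1 -> dzero y i ->
  exists2 w, dowling_step x w & dle w y.
Proof.
move=> [gxy zxy] /gain1P[b xb]; case bi: (b i) => [m|//] _.
case zi: (dzero y i) => [u|//] _.
have zy j v : b j = Some v -> dzero y j = Some (a (v * m^-1) u).
  move=> bj; case: (gxy _ _ _ (color_gain xb bj bi)).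
    by move/(gain_sym (dgain_is_gain y))/(dzero_dgain zi).
  by case=> v' [u' [-> ]]; rewrite zi => -[<-] ->.
(* The only equivariant map sending [m], the color of [i], to the value [u] of [y] at [i]. *)
pose f (h : H) : U := a (h * m^-1) u.
pose z : {ffun I -> option U} :=
  [ffun j => if b j is Some h then Some (f h) else dzero x j].
have g_w j k l : gain (dpart x :\ projectivized b)%SET j k l -> dgain x j k l.
  by move=> [c [v [/setD1P[_ xc] cj ck]]]; exists c, v.
have pp : partial_partition tau (dpart x :\ projectivized b)%SET.
  apply: partial_partition_intro.
  - by move=> C /setD1P[_ /(pp_proj (dpart_pp x))].
  - by move=> c /setD1P[_ /(pp_nonempty (dpart_pp x))].
  - move=> c d j /setD1P[_ xc] /setD1P[_ xd]; exact: pp_disjoint (dpart_pp x) _ _ _ xc xd.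
  - move=> c j /setD1P[_ xc]; exact: pp_sub (dpart_pp x) _ _ xc.
have [|w [pw zw]] := dowling_intro pp (z := z).
  move=> j; rewrite ffunE; case bj: (b j) => [v|].
    split=> // _; split; first by apply: (pp_sub (dpart_pp x) xb); rewrite bj.
    case/gain1P => c /setD1P[/eqP neq xc] cj; apply: neq.
    by apply: (pp_disjoint (dpart_pp x) (i := j)); rewrite ?bj.
  rewrite dzeroP; split=> -[tj n]; split=> //; first by move/g_w.
  move=> /gain1P[c xc cj]; apply: n; apply/gain1P; exists c => //.
  rewrite !inE xc andbT; apply: contraTneq cj => /eq_projectivized[h ->].
  by rewrite ffunE bj.
exists w.
  right; exists (projectivized b), b, f; split; last by rewrite pw zw.
  split; [exact: xb|exact: mem_projectivized|].
  by move=> g h; rewrite /f -mulgA (lactM a g).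
split=> [j k l|j v]; first by rewrite /dgain pw => /g_w/gxy.
by rewrite zw ffunE; case bj: (b j) => [t|] => [[<-]|/zxy//]; exact: zy.
Qed.

Lemma dle_merge_step x y b c i j k :
  dle x y -> projectivized b \in dpart x -> projectivized c \in dpart x ->
  projectivized b != projectivized c -> b i -> c j -> dgain y i j k ->
  exists2 w, dowling_step x w & dle w y.
Proof.
move=> [gxy zxy] xb xc neq; case bi: (b i) => [m|//] _; case cj: (c j) => [p|//] _ yk.
(* Solves [m * (p * h)^-1 = k]: after the merge, the gain from [i] to [j] must be the one found in
   [y]. *)
pose h := p^-1 * k^-1 * m.
set D := cunion b (cmulr c h).
have bD t u : b t = Some u -> D t = Some u by rewrite ffunE => ->.
have cD t u : c t = Some u -> D t = Some (u * h).
  move=> ct; rewrite !ffunE ct; case bt: (b t) => [w|//].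
  by case/eqP: neq; apply: (pp_disjoint (dpart_pp x) (i := t)); rewrite ?bt ?ct.
have DE t : D t -> b t \/ c t.
  by rewrite !ffunE; case: (b t) => [?|]; [left|case: (c t) => [?|//]; right].
pose bt := (projectivized D |: (dpart x :\ projectivized b :\ projectivized c))%SET.
have xbt C : C \in bt -> C != projectivized D ->
    [/\ C \in dpart x, C != projectivized b & C != projectivized c].
  by rewrite !inE => /orP[->//|/and3P[-> -> ->]].
have dis d t : projectivized d \in dpart x -> projectivized d != projectivized b ->
    projectivized d != projectivized c -> d t -> D t -> False.
  move=> xd /eqP db /eqP dc dt /DE[bt'|ct].
    by apply: db; exact: (pp_disjoint (dpart_pp x) xd xb dt).
  by apply: dc; exact: (pp_disjoint (dpart_pp x) xd xc dt).
have pD d : projectivized d = projectivized D -> forall t, d t -> D t.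
  by move=> /eq_projectivized[l ->] t; rewrite ffunE; case: (D t).
have pp : partial_partition tau bt.
  apply: partial_partition_intro.
  - move=> C.
    have [->|neqC /xbt[]// xC _ _] := eqVneq C (projectivized D); first by exists D.
    exact: pp_proj (dpart_pp x) _ xC.
  - move=> d; have [/esym/eq_projectivized[l DE']|neqd /xbt[]// xd _ _] :=
      eqVneq (projectivized d) (projectivized D).
      by exists i; have := bD _ _ bi; rewrite DE' ffunE; case: (d i).
    exact: pp_nonempty (dpart_pp x) _ xd.
  - move=> d e t; have [dD _|neqd /xbt[]// xd db dc] :=
      eqVneq (projectivized d) (projectivized D);
    have [eD _|neqe /xbt[]// xe eb ec] :=
      eqVneq (projectivized e) (projectivized D).
    + by rewrite dD eD.
    + by move=> /(pD _ dD) Dt et; have := dis _ _ xe eb ec et Dt.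
    + by move=> dt /(pD _ eD) Dt; have := dis _ _ xd db dc dt Dt.
    + exact: pp_disjoint (dpart_pp x) _ _ _ xd xe.
  - move=> d t; have [dD _ /(pD _ dD)/DE[]|neqd /xbt[]// xd _ _] :=
      eqVneq (projectivized d) (projectivized D).
    + exact: pp_sub (dpart_pp x) _ _ xb.
    + exact: pp_sub (dpart_pp x) _ _ xc.
    + exact: pp_sub (dpart_pp x) _ _ xd.
(* A merge does not change the set of colored points, so the zero map of [x] can be kept. *)
have dom t : gain bt t t 1 <-> dgain x t t 1.
  rewrite /dgain !gain1P; split=> -[d].
    have [dD _ /(pD _ dD)/DE[]|neqd /xbt[]// xd _ _] :=
      eqVneq (projectivized d) (projectivized D).
    + by exists b.
    + by exists c.
    + by exists d.
  move=> xd dt.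
  have [/eq_projectivized[l dE]|db] := eqVneq (projectivized d) (projectivized b).
    exists D; first exact: finset.setU11.
    by move: dt; rewrite dE ffunE; case bt': (b t) => [u|//]; rewrite (bD _ _ bt').
  have [/eq_projectivized[l dE]|dc] := eqVneq (projectivized d) (projectivized c).
    exists D; first exact: finset.setU11.
    by move: dt; rewrite dE ffunE; case ct: (c t) => [u|//]; rewrite (cD _ _ ct).
  by exists d => //; rewrite !inE xd db dc orbT.
have [|w [pw zw]] := dowling_intro pp (z := dzero x).
  by move=> t; rewrite dzeroP dom.
exists w.
  left; exists (projectivized b), (projectivized c), b, c, h.
  split; last by rewrite pw zw.
  by split=> //; exact: mem_projectivized.
(* It suffices to compare each point of [D] with the base point [i]; points of [c] reach it through
   [j] and the gain [k] of [y]. *)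
have yD t u : D t = Some u -> dgainz y t i (u * m^-1).
  case bt': (b t) => [v|].
    by rewrite (bD _ _ bt') => -[<-]; apply/gxy/(color_gain xb bt' bi).
  case ct: (c t) => [v|]; last by rewrite !ffunE bt' ct.
  rewrite (cD _ _ ct) => -[<-].
  rewrite (_ : _ * _ = (v * p^-1) * k^-1); last by rewrite /h !mulgA mulgK.
  apply: (dgainz_trans (j := j)); first exact/gxy/(color_gain xc ct cj).
  by left; exact: gain_sym (dgain_is_gain y) _ _ _ yk.
split=> [s t l|t v]; last by rewrite zw; exact: zxy.
rewrite /dgain pw => -[d [v [+ dt ds]]].
have [/eq_projectivized[q dE] _|neqd /xbt[]// xd _ _] :=
  eqVneq (projectivized d) (projectivized D).
  move: dt ds; rewrite dE ffunE [cmulr D q s]ffunE.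
  case Dt: (D t) => [u|//] [uv]; case Ds: (D s) => [u'|//] [uv'].
  have := dgainz_trans (yD _ _ Ds) (dgainz_sym (yD _ _ Dt)).
  rewrite invMg invgK !mulgA mulgKV (_ : u' * u^-1 = l) //.
  by apply: (mulIg u); rewrite mulgKV; apply: (mulIg q); rewrite uv' -uv mulgA.
by apply: gxy; exists d, v.
Qed.

(** Each step lowers the number of classes, so it is enough to find one step that stays below [y],
    or else [x = y]. With no color step, no colored point of [x] is in the zero block of [y], so
    gains of [x] are gains of [y]. With no merge step, points linked in [y] already share a class of
    [x]. *)
Lemma dle_dowling_le x y : dle x y -> (x <= y)%O.
Proof.
have [N] := ubnP #|dpart x|; elim: N x => // N IH x cardx xy.
suff [->//|[w xw wy]] : x = y \/ (exists2 w, dowling_step x w & dle w y).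
  apply: (Order.POrderTheory.le_trans (y := w)); first exact/asboolP/rt_step.
  by apply: IH wy; apply: leq_trans (dowling_step_card xw) _.
have [step|no] := pselect (exists2 w, dowling_step x w & dle w y); [by right|left].
have gx := dgain_is_gain x; have gy := dgain_is_gain y.
have [gxy zxy] := xy.
have xNz i : dgain x i i 1 -> dzero y i -> False.
  by move=> ri zi; apply: no; exact: dle_color_step xy ri zi.
have xsuby i j h : dgain x i j h -> dgain y i j h.
  move=> r; case: (gxy _ _ _ r) => // -[u [v [zi _ _]]].
  by have [] := xNz i (gain_refl gx r); rewrite zi.
apply: dowling_eq => [i j h|].
  split=> [/xsuby//|r].
  have /gain1P[b xb bi] := dle_dom xy (gain_refl gy r).
  have /gain1P[c xc cj] := dle_dom xy (gain_refr gy r).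
  have [|neq] := eqVneq (projectivized b) (projectivized c); last first.
    by case: no; exact: dle_merge_step xy xb xc neq bi cj r.
  move=> /esym/eq_projectivized[m cE].
  case bi': (b i) bi => [u|//] _; move: cj; rewrite cE ffunE; case bj: (b j) => [v|//] _.
  have xr : dgain x i j _ := color_gain xb bi' bj.
  by rewrite (gain_inj gy r (xsuby _ _ _ xr)).
apply/ffunP => i; case zi: (dzero x i) => [u|]; first by rewrite (zxy _ _ zi).
case zi': (dzero y i) => [u|//].
have /dzeroP[ti _] : dzero y i by rewrite zi'.
have [r|n] := pselect (dgain x i i 1); first by have [] := xNz i r; rewrite zi'.
by have /dzeroP : i \in tau /\ ~ dgain x i i 1 by []; rewrite zi.
Qed.

Lemma dowling_leP x y : (x <= y)%O <-> dle x y.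
Proof. by split; [exact: dowling_le_dle|exact: dle_dowling_le]. Qed.

End DowlingGain.

(** * Localization at the blocks and at the orbits *)

(** Preserving and reflecting the order makes [Phi] single-valued and injective by antisymmetry, so
    any choice functions in the two directions are mutually inverse. *)
Lemma poset_iso_of_rel d1 d2 (P : porderType d1) (Q : porderType d2)
    (Phi : P -> Q -> Prop) :
  (forall p, exists q, Phi p q) -> (forall q, exists p, Phi p q) ->
  (forall p p' q q', Phi p q -> Phi p' q' -> (p <= p')%O <-> (q <= q')%O) ->
  poset_iso P Q.
Proof.
move=> /choice[f Pf] /choice[g Pg] mono.
exists f; last by move=> p p'; apply/idP/idP; rewrite -(mono _ _ _ _ (Pf p) (Pf p')).
exists g => [p|q]; apply: Order.POrderTheory.le_anti; apply/andP; split.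
- exact/(mono _ _ _ _ (Pg _) (Pf _)).
- exact/(mono _ _ _ _ (Pf _) (Pg _)).
- exact/(mono _ _ _ _ (Pf _) (Pg _)).
- exact/(mono _ _ _ _ (Pg _) (Pf _)).
Qed.

(** * Set partitions as equivalence relations, refinement as inclusion *)

Section SameBlock.
Context {I : finType} {B : {set I}}.
Implicit Types p q : set_partition B.

Definition same_block p (i j : I) : Prop :=
  exists2 A, A \in sp_blocks p & i \in A /\ j \in A.

Lemma same_block_sub p i j : same_block p i j -> i \in B.
Proof.
have /and3P[/eqP cov _ _] := valP p; case=> A pA [iA _].
have : i \in finset.cover (val p) by apply/finset.bigcupP; exists A.
by rewrite cov.
Qed.

Lemma same_block_refl p i : i \in B -> same_block p i i.
Proof.
have /and3P[/eqP cov _ _] := valP p => iB.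
have : i \in finset.cover (val p) by rewrite cov.
by case/finset.bigcupP => A pA iA; exists A.
Qed.

Lemma same_block_sym p i j : same_block p i j -> same_block p j i.
Proof. by case=> A pA [iA jA]; exists A. Qed.

Lemma same_block_trans p i j k :
  same_block p i j -> same_block p j k -> same_block p i k.
Proof.
have /and3P[_ triv _] := valP p; case=> A pA [iA jA] [C pC [jC kC]].
exists A => //; split=> //.
by rewrite -(def_pblock triv pA jA) (def_pblock triv pC jC).
Qed.

Lemma set_partition_leP p q :
  (p <= q)%O <-> (forall i j, same_block p i j -> same_block q i j).
Proof.
split=> [/finerP pq i j [A pA [iA jA]]|pq].
  have [C qC /fintype.subsetP AC] := pq A pA.
  by exists C => //; split; apply: AC.
apply/finerP => A pA; have /and3P[_ triv p0] := valP p.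
have /finset.set0Pn[i iA] : A != finset.set0 by apply: contraNneq p0 => <-.
have [C qC [iC _]] : same_block q i i by apply: pq; exists A.
exists C => //; apply/fintype.subsetP => j jA.
have [D qD [iD jD]] : same_block q i j by apply: pq; exists A.
have /and3P[_ trivq _] := valP q.
by rewrite -(def_pblock trivq qC iC) (def_pblock trivq qD iD).
Qed.

(** Reflexivity is local to [B] because [E] will be the existence of a gain, a partial equivalence
    relation on all indices. *)
Lemma set_partition_of_per (E : I -> I -> Prop) :
  (forall i, i \in B -> E i i) -> (forall i j, E i j -> E j i) ->
  (forall i j k, E i j -> E j k -> E i k) ->
  exists p : set_partition B,
    forall i j, i \in B -> j \in B -> (same_block p i j <-> E i j).
Proof.
move=> Er Es Et; pose e i j := `[< E i j >].
have eqe : {in B & &, equivalence_rel e}.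
  move=> i j k iB jB kB; split; first exact/asboolP/Er.
  move=> /asboolP ij; apply/asboolP/asboolP; apply: Et => //.
  exact: Es.
exists (SetPartition (equivalence_partitionP eqe)) => i j iB jB.
have pE := pblock_equivalence_partition eqe iB jB.
have /and3P[/eqP cov triv _] := equivalence_partitionP eqe.
split=> [[A /= pA [iA jA]]|ij].
  by apply/asboolP; rewrite -[`[<_>]]pE (def_pblock triv pA iA).
exists (finset.pblock (equivalence_partition e B) i); rewrite /=.
  by rewrite finset.pblock_mem ?cov.
by rewrite finset.mem_pblock cov pE; split=> //; apply/asboolP.
Qed.

End SameBlock.

(** * Fibers of the zero map over the orbits *)

Section ZeroFiber.
Context {I : finType} {tau : {set I}} {G : finGroupType} {X : choiceType}.
Context {a : laction G X} {A : set X} {hA : invariant_set a A}.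
Implicit Types x y : dowling tau (restr_action hA).

Lemma zero_fiberP (z : {ffun I -> option (set_type A)}) o i :
  i \in zero_fiber z o <-> exists2 u, z i = Some u & o (val u).
Proof.
rewrite inE; case: (z i) => [u|]; last by split=> // -[].
by split=> [/set_mem ou|[_ [<-]] /mem_set]; [exists u|].
Qed.

Lemma orbits_eq o o' v : orbits a A o -> orbits a A o' -> o v -> o' v -> o = o'.
Proof.
have sub u w g k : a g u = a k w -> orbit_of a u `<=` orbit_of a w.
  move=> e _ [h _ <-]; exists (h * g^-1 * k)%g => //.
  by rewrite lactM -e -lactM mulgKV.
move=> [u _ <-] [w _ <-] [g _ <-] [k _ e].
by apply/seteqP; split; [apply: (sub u w g k)|apply: (sub w u k g)].
Qed.

Lemma orbits_orbit_of v : A v -> orbits a A (orbit_of a v).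
Proof. by exists v. Qed.

Lemma orbit_of_refl v : orbit_of a v v.
Proof. by exists 1%g; rewrite ?lact1. Qed.

Lemma zero_fiber_dgain x o i j h :
  i \in zero_fiber (dzero x) o -> dgain x i j h -> False.
Proof. by case/zero_fiberP => u zi _; exact: dzero_dgain zi. Qed.

Lemma zero_fiber_eq x o o' i : orbits a A o -> orbits a A o' ->
  i \in zero_fiber (dzero x) o -> i \in zero_fiber (dzero x) o' -> o = o'.
Proof.
move=> oA oA' /zero_fiberP[u zi ou] /zero_fiberP[u' zi' ou'].
by move: zi' ou'; rewrite zi => -[<-] /(orbits_eq oA oA' ou).
Qed.

Lemma dzero_fiber x i u : dzero x i = Some u ->
  exists2 o, orbits a A o & i \in zero_fiber (dzero x) o.
Proof.
move=> zi; exists (orbit_of a (val u)); first exact/orbits_orbit_of/set_mem/valP.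
by apply/zero_fiberP; exists u => //; exact: orbit_of_refl.
Qed.

Variable s : set X -> X.
Hypothesis s_in : forall o, orbits a A o -> o (s o).

(** One [g] serves all orbits, since the value at [i] lies in a single orbit. *)
Definition fiber_section x (g : I -> G) : Prop :=
  forall o i u, orbits a A o -> dzero x i = Some u -> o (val u) ->
    a (g i) (s o) = val u.

Lemma fiber_section_exists x : exists g, fiber_section x g.
Proof.
suff /choice[g gP] : forall i, exists g, forall o u, orbits a A o ->
    dzero x i = Some u -> o (val u) -> a g (s o) = val u.
  by exists g => o i u; exact: gP.
move=> i; case zi: (dzero x i) => [u|]; last by exists 1%g.
have uA : orbits a A (orbit_of a (val u)) by exact/orbits_orbit_of/set_mem/valP.
have uu := orbit_of_refl (val u).
have [h _ hs] := s_in uA.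
exists h^-1%g => o _ oA [<-] ou; rewrite -(orbits_eq uA oA uu ou) -hs.
by rewrite -lactM mulVg lact1.
Qed.

End ZeroFiber.

(** * Splitting and gluing gains below a fixed element *)

Section Localization.
Context {I : finType} {tau : {set I}} {G : finGroupType} {X : choiceType}.
Context {a : laction G X} {A : set X} {hA : invariant_set a A}.
Variables (s : set X -> X) (x : dowling tau (restr_action hA)) (g : I -> G).
Hypothesis gP : fiber_section s x g.
Implicit Types (y : dowling tau (restr_action hA)) (o : set X).
Local Open Scope group_scope.

Local Notation fiber o := (zero_fiber (dzero x) o).
Local Notation Stab o := (subg_of (stabilizer_group a (s o))).
Local Notation local_lattice o :=
  (dowling (fiber o) (trivial_action (Stab o) unit)).

Lemma dgainz_fiber o i j h : orbits a A o -> i \in fiber o -> j \in fiber o ->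
  (dgainz x i j h <-> a (g i) (s o) = a h (a (g j) (s o))).
Proof.
move=> oA io jo; have /zero_fiberP[u zi ou] := io; have /zero_fiberP[v zj ov] := jo.
rewrite (gP oA zi ou) (gP oA zj ov); split=> [[/(zero_fiber_dgain io)//|]|e].
  move=> [u' [v' [+ + uE]]]; rewrite zi zj => -[->] [->].
  by rewrite uE.
by right; exists u, v; split=> //; apply: val_inj.
Qed.

Lemma dgainz_fiber_twist o i j (h : Stab o) : orbits a A o ->
  i \in fiber o -> j \in fiber o -> dgainz x i j (g i * sgval h * (g j)^-1).
Proof.
move=> oA io jo; apply/(dgainz_fiber _ oA io jo).
rewrite -lactM mulgKV lactM; congr (a _ _); apply/esym/eqP.
by have := subgP h; rewrite inE.
Qed.

(** On the zero block, [h] moves the value at [j] to the value at [i]. The two values thus share an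
    orbit, and [(g i)^-1 * h * g j] fixes its base point. *)
Lemma dgainz_fiber_untwist o i j h : orbits a A o ->
  i \in fiber o -> dgainz x i j h ->
  j \in fiber o /\ exists k : Stab o, h = g i * sgval k * (g j)^-1.
Proof.
move=> oA io r; have [v zj] : exists v, dzero x j = Some v.
  by case: r => [/(zero_fiber_dgain io)//|[u [v [_ zj _]]]]; exists v.
have [ o' oA' jo'] := dzero_fiber zj.
have jo : j \in fiber o.
  case: r => [/(zero_fiber_dgain io)//|[u [v' [zi zj' uE]]]].
  have /zero_fiberP[u' zi' ou] := io; move: zi'; rewrite zi => -[uu].
  apply/zero_fiberP; exists v' => //.
  move: ou; rewrite -{u'}uu uE /=; case: oA => w _ <- [k _ e].
  by exists (h^-1 * k) => //; rewrite lactM e -lactM mulVg lact1.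
split=> //; move/(dgainz_fiber _ oA io jo): r => e.
have st : (g i)^-1 * h * g j \in stabilizer a (s o).
  by rewrite inE !lactM -e -lactM mulVg lact1.
by exists (subg _ ((g i)^-1 * h * g j)); rewrite subgK // !mulgA mulgV mul1g mulgK.
Qed.

(* With z(i) = g_i s_o on the fiber over o, the rule z(i) = f(b(i)) with
   f(1) = s_o makes g_i^-1 b(i) a coloring by the stabilizer of s_o; e has the
   gains of these colorings. *)
Definition twist o y (e : local_lattice o) : Prop :=
  forall i j, i \in fiber o -> j \in fiber o -> forall h : Stab o,
    (dgain e i j h <-> dgain y i j (g i * sgval h * (g j)^-1)).

Lemma twist_dom o y (e : local_lattice o) i : twist y e -> i \in fiber o ->
  (dgain e i i 1 <-> dgain y i i 1).
Proof. by move=> tw io; rewrite (tw i i io io) /= mulg1 mulgV. Qed.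

Lemma local_dzero o (e : local_lattice o) i :
  dzero e i = Some tt <-> i \in fiber o /\ ~ dgain e i i 1.
Proof. by rewrite -dzeroP; case: (dzero e i) => [[]|]. Qed.

Lemma local_dgain_mem o (e : local_lattice o) i j h : dgain e i j h ->
  i \in fiber o /\ j \in fiber o.
Proof.
move=> r; have ge := dgain_is_gain e.
split; apply: (dgain1_sub (x := e)).
  exact: gain_refl ge _ _ _ r.
exact: gain_refr ge _ _ _ r.
Qed.

Lemma fiber_mem o i : i \in fiber o -> i \in tau.
Proof. by case/zero_fiberP => u zi _; have /dzeroP[] : dzero x i by rewrite zi. Qed.

(** The zero map of [y] is a restriction of that of [x], so the points of the fiber left uncolored
    are those that [y] sends into [o]. This carries the no-singleton condition between [y] and its
    local components, in both directions. *)
Lemma twist_zero_block o y (e : local_lattice o) : dle y x -> twist y e ->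
  zero_block (fiber o) (dpart e) = zero_fiber (dzero y) o.
Proof.
move=> [_ yx] tw; apply/setP => i; apply/idP/idP.
  case/mem_zero_block => io n.
  have /dzeroP : i \in tau /\ ~ dgain y i i 1.
    by split; [exact: fiber_mem io|move/(twist_dom tw io)].
  case zi: (dzero y i) => [u|//] _; apply/zero_fiberP; exists u => //.
  by have /zero_fiberP[v] := io; rewrite (yx _ _ zi) => -[<-].
case/zero_fiberP => u zi ou; apply/mem_zero_block.
have io : i \in fiber o by apply/zero_fiberP; exists u => //; exact: yx.
by split=> // /(twist_dom tw io); exact: dzero_dgain zi.
Qed.

(** Gains of [y] on the fiber that are not of the form [g i * sgval k * (g j)^-1] are dropped; for
    [y] below [x] there are none, by [dgainz_fiber_untwist]. *)
Lemma twist_exists o y : exists e : local_lattice o, twist y e.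
Proof.
have gy := dgain_is_gain y.
pose R i j (h : Stab o) := [/\ i \in fiber o, j \in fiber o &
  dgain y i j (g i * sgval h * (g j)^-1)].
have gR : is_gain R.
  split=> [i j h [io jo r]|i j k h l [io jo r] [_ ko r']|i h [io _]].
  - split=> //; have := gain_sym gy r.
    by rewrite !invMg invgK mulgA.
  - split=> //; have := gain_trans gy r r'.
    by rewrite !mulgA mulgKV -(mulgA (g i)).
  - move=> /(gain_id gy) e; apply: val_inj => /=.
    by apply: (mulgI (g i)); apply: (mulIg (g i)^-1); rewrite e mulg1 mulgV.
pose z : {ffun I -> option unit} :=
  [ffun i => if `[< i \in fiber o /\ ~ R i i 1 >] then Some tt else None].
have [|i|e [eR _]] := @dowling_of_gain _ (fiber o) _ _
    (trivial_action (Stab o) unit) R z gR.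
- by move=> i [].
- by rewrite ffunE; case: asboolP.
exists e => i j io jo h; rewrite eR; split=> [[]//|r].
by split.
Qed.

Lemma twist_le o y y' (e e' : local_lattice o) : orbits a A o -> twist y e ->
  twist y' e' -> dle y y' -> (e <= e')%O.
Proof.
move=> oA tw tw' [yy' zyy']; apply/dowling_leP; split.
  move=> i j h r; have [io jo] := local_dgain_mem r.
  case: (yy' _ _ _ ((tw i j io jo h).1 r)) => [r'|[u [v [zi zj _]]]].
    by left; apply/(tw' i j io jo).
  (* The action on [unit] is trivial, so this alternative only asks that both points lie in the zero
     block of [e']. *)
  right; exists tt, tt; split=> //; apply/local_dzero; split=> //.
    by move/(twist_dom tw' io); exact: dzero_dgain zi.
  by move/(twist_dom tw' jo); exact: dzero_dgain zj.
move=> i [] /local_dzero[io n]; apply/local_dzero; split=> // r'.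
have /dzeroP : i \in tau /\ ~ dgain y i i 1.
  by split; [exact: fiber_mem io|move/(twist_dom tw io)].
case zi: (dzero y i) => [u|//] _.
by apply: (dzero_dgain (zyy' _ _ zi)); exact/(twist_dom tw' io).
Qed.

(** Inside a block of [x] it is enough that [y'] links the two points: its gain and that of [y] must
    both be the gain of [x]. *)
Lemma dle_local y y' : dle y x -> dle y' x ->
  (forall i j h, dgain x i j h -> dgain y i j h -> exists k, dgain y' i j k) ->
  (forall o, orbits a A o -> exists e e' : local_lattice o,
     [/\ twist y e, twist y' e' & (e <= e')%O]) ->
  dle y y'.
Proof.
move=> [yx zyx] [y'x zy'x] blk loc; have gx := dgain_is_gain x.
have z_y' o i (e' : local_lattice o) : i \in fiber o -> twist y' e' ->
    dzero e' i -> dzero y' i = dzero x i.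
  move=> io tw' /dzeroP[_ n].
  have /dzeroP : i \in tau /\ ~ dgain y' i i 1.
    by split; [exact: fiber_mem io|move/(twist_dom tw' io)].
  by case zi: (dzero y' i) => [u|//] _; rewrite (zy'x _ _ zi).
split=> [i j h r|i u zi]; last first.
  have [ o oA io] := dzero_fiber (zyx _ _ zi).
  have [e [e' [tw tw' /dowling_leP[_ zee']]]] := loc o oA.
  rewrite (z_y' o i e' io tw') ?(zyx _ _ zi) // (zee' i tt) //.
  apply/local_dzero; split=> //; move/(twist_dom tw io); exact: dzero_dgain zi.
(* A gain of [y] either is a gain of [x], inside one of its blocks, or is realized by the zero map
   of [x], inside one orbit fiber. *)
case: (yx _ _ _ r) => [rx|[u [v [zi zj uE]]]].
  have [k r'] := blk _ _ _ rx r; left.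
  case: (y'x _ _ _ r') => [rx'|[u [v [zi _ _]]]].
    by rewrite (gain_inj gx rx rx').
  by have := dzero_dgain zi rx.
have [ o oA io] := dzero_fiber zi.
have [jo [k hE]] := dgainz_fiber_untwist oA io (yx _ _ _ r).
have [e [e' [tw tw' /dowling_leP[ee' _]]]] := loc o oA.
have /ee'[re'|[t [t' [zi' zj' _]]]] : dgain e i j k by apply/tw => //; rewrite -hE.
  by left; rewrite hE; apply/tw'.
right; exists u, v; rewrite (z_y' o i e') ?zi' // (z_y' o j e') ?zj' //.
Qed.

(** [E] prescribes unlabeled links inside the blocks, with labels forced by [x]; [Q] prescribes
    labeled ones on the fibers, conjugated by [g]. These pieces have disjoint domains, so their
    union is again a gain relation. *)
Lemma dle_glue (E : I -> I -> Prop) (Q : forall o, I -> I -> Stab o -> Prop) :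
  (forall i j, E i j -> E j i) -> (forall i j k, E i j -> E j k -> E i k) ->
  (forall i, dgain x i i 1 -> E i i) ->
  (forall i j, E i j -> exists h, dgain x i j h) ->
  (forall o, is_gain (Q o)) ->
  (forall o i, Q o i i 1 -> i \in fiber o) ->
  exists y, [/\ dle y x,
    forall i j, dgain x i i 1 -> ((exists h, dgain y i j h) <-> E i j) &
    forall o, orbits a A o -> forall i j, i \in fiber o -> j \in fiber o ->
      forall h, dgain y i j (g i * sgval h * (g j)^-1) <-> Q o i j h].
Proof.
move=> Es Et Er Ex gQ Qsub; have gx := dgain_is_gain x.
have Qi o i j h : Q o i j h -> i \in fiber o.
  by move/(gain_refl (gQ o)); exact: Qsub.
have Qj o i j h : Q o i j h -> j \in fiber o.
  by move/(gain_refr (gQ o)); exact: Qsub.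
have Ei i j : E i j -> dgain x i i 1 by case/Ex => h; exact: gain_refl.
have Ej i j : E i j -> dgain x j j 1 by move/Es/Ei.
have disj o i : i \in fiber o -> dgain x i i 1 -> False.
  exact: zero_fiber_dgain.
pose R i j h := (E i j /\ dgain x i j h) \/
  exists o k, [/\ orbits a A o, Q o i j k & h = g i * sgval k * (g j)^-1].
have gR : is_gain R.
  split=> [i j h [[e r]|[ o [k [oA q ->]]]]|i j k h l|i h].
  - by left; split; [exact: Es|exact: gain_sym].
  - right; exists o, k^-1; split=> //; first exact: gain_sym.
    by rewrite !invMg invgK mulgA.
  - move=> [[e r]|[ o [m [oA q ->]]]] [[e' r']|[ o' [m' [oA' q' ->]]]].
    + by left; split; [exact: Et e'|exact: gain_trans r'].
    + by have := disj _ _ (Qi _ _ _ _ q') (Ej _ _ e).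
    + by have := disj _ _ (Qj _ _ _ _ q) (Ei _ _ e').
    + have oo := zero_fiber_eq oA oA' (Qj _ _ _ _ q) (Qi _ _ _ _ q').
      subst o'; right; exists o, (m * m'); split=> //.
        exact: gain_trans q q'.
      by rewrite !mulgA mulgKV -(mulgA (g i)).
  - case=> [[_ /(gain_id gx)//]|[ o [k [oA /(gain_id (gQ o)) -> ->]]]].
    by rewrite mulg1 mulgV.
(* Reflexivity of [E] on the blocks keeps every point colored by [x] colored, so each remaining
   point has a value in the zero map of [x]. *)
pose z : {ffun I -> option (set_type A)} :=
  [ffun i => if `[< R i i 1 >] then None else dzero x i].
have Rtau i : R i i 1 -> i \in tau.
  case=> [[_ r]|[ o [k [_ /Qi/fiber_mem//]]]]; exact: dgain1_sub r.
have zE i : z i <-> i \in tau /\ ~ R i i 1.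
  rewrite ffunE; case: asboolP => r; first by split=> // -[].
  rewrite dzeroP; split=> -[ti _]; split=> // rx.
  by apply: r; left; split=> //; exact: Er.
have [y [yR yz]] := dowling_of_gain (restr_action hA) gR Rtau zE.
exists y; split.
- split=> [i j h /yR[[_ r]|[ o [k [oA q ->]]]]|i u].
  + by left.
  + by apply: dgainz_fiber_twist => //; [exact: Qi q|exact: Qj q].
  + by rewrite yz ffunE; case: asboolP.
- move=> i j ri; split=> [[h /yR[[]//|[ o [k [_ /Qi io _]]]]]|e].
    by have := disj _ _ io ri.
  by have [h r] := Ex _ _ e; exists h; apply/yR; left.
- move=> o oA i j io jo h; rewrite yR; split=> [[[e _]|[ o' [k [oA' q e]]]]|q].
  + by have := disj _ _ io (Ei _ _ e).
  + have oo := zero_fiber_eq oA oA' io (Qi _ _ _ _ q); subst o'.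
    suff -> : h = k by [].
    by apply: val_inj; apply: (mulgI (g i)); exact: (mulIg (g j)^-1).
  + by right; exists o, h.
Qed.

End Localization.

(** * Assembling the isomorphism *)

Lemma orbits_setU_split (G : finGroupType) (X : choiceType) (a : laction G X)
    (A B : set X) o :
  orbits a (A `|` B) o <-> orbits a A o \/ (orbits a B `\` orbits a A) o.
Proof.
split=> [oAB|[[u Au <-]|[[u Bu <-] _]]]; last 2 first.
- by exists u => //; left.
- by exists u => //; right.
have [?|n] := pselect (orbits a A o); [by left|right].
by split=> //; case: oAB n => u [] uA <- n; [case: n|]; exists u.
Qed.

Lemma subposet_le d (P : porderType d) (r : pred P) (u v : subposet r) :
  (u <= v)%O = (subposet_val u <= subposet_val v)%O.
Proof. by []. Qed.

Lemma pair_le (d1 d2 d : Order.disp_t) (P : porderType d1) (Q : porderType d2)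
    (p q : (P *prod[d] Q)%type) :
  (p <= q)%O <-> (p.1 <= q.1)%O /\ (p.2 <= q.2)%O.
Proof. by split=> /andP. Qed.

Lemma poset_prod_le d J (P : J -> porderType d) (p q : poset_prod P) :
  (p <= q)%O <-> forall j, (p j <= q j)%O.
Proof. by split=> /asboolP. Qed.

Theorem theorem3p17 (G : finGroupType) (X : topologicalType)
    (a : laction G X) (a_cont : forall g : G, continuous (a g))
    (X_connected : connected [set: X])
    (S_finite : finite_set (Sing a))
    (T : set X) (T_finite : finite_set T) (T_inv : invariant_set a T)
    (s : set X -> X)
    (s_in : forall o : set X, orbits a (T `|` Sing a) o -> o (s o))
    (n : nat) (x : dowlingT n T_inv (Sing_invariant (a := a))) :
  poset_iso
    (lower_set x)
    (poset_prod (fun B : {B : {set 'I_n} | B \in blocks (dpart (subposet_val x))} =>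
        set_partition (val B))
     *prod[poset_display]
     poset_prod (fun o : set_type (orbits a T) =>
        dowling_lattice (zero_fiber (dzero (subposet_val x)) (val o))
          (subg_of (stabilizer_group a (s (val o)))))
     *prod[poset_display]
     poset_prod (fun o : set_type (orbits a (Sing a) `\` orbits a T) =>
        dowling_lattice' (zero_fiber (dzero (subposet_val x)) (val o))
          (subg_of (stabilizer_group a (s (val o))))))%type.
Proof.
set xv := subposet_val x.
have [g gP] := fiber_section_exists s_in xv.
have orbT (o : set_type (orbits a T)) : orbits a (T `|` Sing a) (val o).
  by apply/orbits_setU_split; left; exact/set_mem/valP.
have orbS (o : set_type (orbits a (Sing a) `\` orbits a T)) :
    orbits a (T `|` Sing a) (val o).
  by apply/orbits_setU_split; right; exact/set_mem/valP.
pose base (p : lower_set x) := subposet_val (subposet_val p).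
have base_le p : dle (base p) xv by apply/dowling_leP; exact: valP p.
have block_dom (B : {B : {set 'I_n} | B \in blocks (dpart xv)}) i :
    i \in val B -> dgain xv i i 1%g.
  move=> iB; have [|h] := (dgain_blocks xv i i).2.
    by exists (val B); [exact: valP|].
  exact: gain_refl (dgain_is_gain xv) _ _ _.
(* On a block of [x] only the existence of a gain is recorded, as its label is that of [x]. *)
pose Phi (p : lower_set x) (q :
    poset_prod (fun B : {B : {set 'I_n} | B \in blocks (dpart xv)} =>
      set_partition (val B)) *
    poset_prod (fun o : set_type (orbits a T) =>
      dowling_lattice (zero_fiber (dzero xv) (val o))
        (subg_of (stabilizer_group a (s (val o))))) *
    poset_prod (fun o : set_type (orbits a (Sing a) `\` orbits a T) =>
      dowling_lattice' (zero_fiber (dzero xv) (val o))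
        (subg_of (stabilizer_group a (s (val o)))))) := [/\
  forall (B : {B : {set 'I_n} | B \in blocks (dpart xv)}) i j,
    i \in val B -> j \in val B ->
    (same_block (q.1.1 B) i j <-> exists h, dgain (base p) i j h),
  forall o : set_type (orbits a T), twist (s := s) (x := xv) g (base p) (q.1.2 o) &
  forall o : set_type (orbits a (Sing a) `\` orbits a T),
    twist (s := s) (x := xv) g (base p) (subposet_val (q.2 o))].
set Q := (Q in poset_iso _ Q).
apply: (@poset_iso_of_rel _ _ _ Q Phi).
- move=> p; have gp := dgain_is_gain (base p).
  have partE (B : {B : {set 'I_n} | B \in blocks (dpart xv)}) :
      exists q : set_partition (val B), forall i j,
      i \in val B -> j \in val B ->
      (same_block q i j <-> exists h, dgain (base p) i j h).
    apply: set_partition_of_per => [i iB|i j [h r]|i j k [h r] [l r']].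
    + by exists 1%g; exact: dle_dom (base_le p) (block_dom B i iB).
    + by exists h^-1%g; exact: gain_sym.
    + by exists (h * l)%g; exact: gain_trans r'.
  have twT : forall o : set_type (orbits a T), _ :=
    fun o => twist_exists s xv g (val o) (base p).
  have twS (o : set_type (orbits a (Sing a) `\` orbits a T)) :
      exists e : dowling_lattice' (zero_fiber (dzero xv) (val o))
        (subg_of (stabilizer_group a (s (val o)))),
      twist (s := s) (x := xv) g (o := val o) (base p) (subposet_val e).
    have [e tw] := twist_exists s xv g (val o) (base p).
    suff e1 : zero_not_singleton e by exists (Subposet e1).
    rewrite /zero_not_singleton (twist_zero_block (base_le p) tw).
    have /asboolP := valP (subposet_val p); apply.
    exact/set_mem/valP.
  exists ((fun B => projT1 (cid (partE B)), fun o => projT1 (cid (twT o))),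
          fun o => projT1 (cid (twS o))).
  split=> [B|o|o] /=; by [case: cid].
- move=> q.
  (* [dle_glue] takes one family over all sets [o], while [q] holds two families indexed by
     membership proofs. They are merged by cases, proof irrelevance making the result independent of
     the proof. *)
  have eq_local (o : set X) : exists e : dowling (zero_fiber (dzero xv) o)
      (trivial_action (subg_of (stabilizer_group a (s o))) unit),
      (forall oT : o \in orbits a T, e = q.1.2 (exist _ o oT)) /\
      (forall oS : o \in orbits a (Sing a) `\` orbits a T,
        e = subposet_val (q.2 (exist _ o oS))).
    have [oT|nT] := pselect (o \in orbits a T).
      exists (q.1.2 (exist _ o oT)); split=> [oT'|oS].
        by rewrite (bool_irrelevance oT oT').
      by case: (set_mem oS) => _ []; exact: set_mem oT.
    have [oS|nS] := pselect (o \in orbits a (Sing a) `\` orbits a T).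
      exists (subposet_val (q.2 (exist _ o oS))); split=> [oT|oS'].
        by have := nT oT.
      by rewrite (bool_irrelevance oS oS').
    (* A dummy value for sets [o] in neither index type. *)
    have [e _] := twist_exists s xv g o xv.
    by exists e; split=> [oT|oS]; [have := nT oT|have := nS oS].
  pose e o := projT1 (cid (eq_local o)).
  have eT (o : set_type (orbits a T)) : e (val o) = q.1.2 o.
    by case: o => o oT; exact: (projT2 (cid (eq_local o))).1.
  have eS (o : set_type (orbits a (Sing a) `\` orbits a T)) :
      e (val o) = subposet_val (q.2 o).
    by case: o => o oS; exact: (projT2 (cid (eq_local o))).2.
  pose E i j := exists B, same_block (q.1.1 B) i j.
  have Eval (B C : {B : {set 'I_n} | B \in blocks (dpart xv)}) i :
      i \in val B -> i \in val C -> B = C.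
    by move=> iB iC; apply/val_inj/(dblocks_eq (valP B) (valP C) iB iC).
  have [||||||y [yx yE yQ]] := dle_glue gP (E := E) (Q := fun o => dgain (e o)).
  + by move=> i j [B /same_block_sym ij]; exists B.
  + move=> i j k [B ij] [C jk]; have jB := same_block_sub (same_block_sym ij).
    have BC := Eval B C j jB (same_block_sub jk); subst C.
    by exists B; exact: same_block_trans ij jk.
  + move=> i r; have [|B xB [iB _]] := (dgain_blocks xv i i).1; first by exists 1%g.
    by exists (exist _ B xB); exact: same_block_refl.
  + move=> i j [B ij]; apply/dgain_blocks; exists (val B); first exact: valP.
    by split; [exact: same_block_sub ij|exact: same_block_sub (same_block_sym ij)].
  + by move=> o; exact: dgain_is_gain.
  + by move=> o i; exact: dgain1_sub.
  have tw o : orbits a (T `|` Sing a) o -> twist g y (e o).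
    by move=> oA i j io jo h; rewrite yQ.
  have y1 : dowlingT_condition y.
    apply/asboolP => o oS.
    have oA : orbits a (T `|` Sing a) o by apply/orbits_setU_split; right.
    rewrite -(twist_zero_block yx (tw o oA)) (eS (exist _ o (mem_set oS))).
    exact: valP (q.2 (exist _ o (mem_set oS))).
  have y2 : (Subposet y1 <= x)%O by apply/dowling_leP.
  have [p bp] : exists p : lower_set x, base p = y.
    by exists (@Subposet _ (dowlingT n T_inv (Sing_invariant (a := a)))
      (fun w => (w <= x)%O) (Subposet y1) y2).
  exists p; rewrite /Phi bp; split=> [B i j iB jB|o|o].
  + rewrite yE; last exact: block_dom iB.
    split=> [|[C ij]]; first by exists B.
    by rewrite (Eval B C i iB (same_block_sub ij)).
  + by rewrite -eT; exact/tw/orbT.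
  + by rewrite -eS; exact/tw/orbS.
- move=> p p' q q' [blk twT twS] [blk' twT' twS'].
  rewrite !subposet_le !pair_le !poset_prod_le dowling_leP.
  split=> [le|[[leB leT] leS]].
    have [le1 _] := le; split; first split.
    - move=> B; apply/set_partition_leP => i j ij.
      have iB := same_block_sub ij; have jB := same_block_sub (same_block_sym ij).
      apply/blk' => //; have [h r] := (blk B i j iB jB).1 ij.
      (* The second alternative would put [i] in the zero block of [x], but [i] lies in the block
         [B]. *)
      case: (le1 _ _ _ r) => [r'|[u [v [zi _ _]]]]; first by exists h.
      have zi' := (base_le p').2 _ _ zi.
      by have := dzero_dgain zi' (block_dom B i iB).
    - by move=> o; exact: twist_le (orbT o) (twT o) (twT' o) le.
    - by move=> o; exact: twist_le (orbS o) (twS o) (twS' o) le.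
  apply: (dle_local gP) => //; try exact: base_le.
    move=> i j h rx r.
    have [|B xB [iB jB]] := (dgain_blocks xv i j).1; first by exists h.
    pose Bs : {B : {set 'I_n} | B \in blocks (dpart xv)} := exist _ B xB.
    apply/(blk' Bs) => //; move/set_partition_leP: (leB Bs); apply.
    by apply/blk => //; exists h.
  move=> o /orbits_setU_split[] /mem_set oA.
    exists (q.1.2 (exist _ o oA)), (q'.1.2 (exist _ o oA)).
    split; [exact: (twT (exist _ o oA))|exact: (twT' (exist _ o oA))|].
    exact: (leT (exist _ o oA)).
  exists (subposet_val (q.2 (exist _ o oA))), (subposet_val (q'.2 (exist _ o oA))).
  split; [exact: (twS (exist _ o oA))|exact: (twS' (exist _ o oA))|].
  exact: (leS (exist _ o oA)).
Qed.
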